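(* The following hold: (1) If $p$ is a prime with $p\equiv 5\pmod 8$, then $64p\in S(16)$; (2) If $p$ is a prime with $p\equiv 3 \pmod 8$, then $64p^2\in S(16)$; (3) If $p$ is a prime with $p = a^2+b^2\equiv 1\pmod 8$ for integers $a,b$ such that both $a+b$ and $a-b$ lie in $\{8m\pm 3\mid m\in\mathbb{Z}\}$, then $64p\in S(16)$.
   Context: $S(16)$ is the set of all values $D(a_0,\dots,a_{15})$ with $a_i\in\mathbb{Z}$, where $D(a_0,\dots,a_{15})$ is the determinant of the $16\times16$ circulant matrix whose $(i,j)$ entry ($0\le i,j\le15$) is $a_{(i-j)\bmod 16}$. *)

(* Defs.v *)
From mathcomp Require Import all_boot all_order all_algebra.
Set Implicit Arguments.
Unset Strict Implicit.
Unset Printing Implicit Defensive.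
Import GRing.Theory.
Local Open Scope ring_scope.

(* The difference i - j is taken in the additive group 'I_n.+1 of integers
   modulo n.+1, so that the (i, j) entry has index (i - j) mod n.+1. *)
Definition circulant (R : Type) (n : nat) (a : 'I_n.+1 -> R) : 'M[R]_n.+1 :=
  \matrix_(i, j) a (i - j).

Definition D (n : nat) (a : 'I_n.+1 -> int) : int := \det (circulant a).

Definition S16 (d : int) : Prop := exists a : 'I_16 -> int, D a = d.

Definition pm3_mod8 (x : int) : Prop :=
  exists m : int, x = 8 * m + 3 \/ x = 8 * m - 3.

(* Main.v *)
Require Import Defs.
From mathcomp Require Import all_boot all_order all_algebra.
From mathcomp Require Import all_field ring lra zify.
Import Order.TTheory GRing.Theory Num.Theory.
Local Open Scope ring_scope.

(** The circulant determinant of [F] is the product of the values of [F] at the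
16th roots of unity, i.e. [F(1) F(-1)] times the norms of [F(i)], [F(zeta_8)]
and [F(zeta_16)]. Adding to [F] a multiple of [(x^16 - 1) / (x^2 + 1)] (resp.
[(x^16 - 1) / (x^4 + 1)]) moves [F(i)] by multiples of 8 (resp. [F(zeta_8)] by
multiples of 4) and leaves the other values alone. Starting from
[-(x + x^4 + x^8 + x^12)] one reaches all [32 (u^2 + v^2)] with [u = 3] and
[v = 1 mod 8]; starting from [1 + x^2 + x^9 + x^10] one reaches [32 N(q)] for
[q = 1 + zeta_8 + 2 zeta_8^2 mod 4], hence, by the symmetries of the norm, for
every [q] whose relative norm to [Z[i]] has both coordinates [+-3 mod 8].
It remains to write [2 p] or [2 p^2] in these forms: [p = a^2 + b^2] gives
[2 p = (a + b)^2 + (a - b)^2]; [p = c^2 + 2 d^2] gives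
[q = (1 - zeta_8) (c + d sqrt(-2))], of relative norm [p (1 - i)]; and a prime
[p = 1 mod 8] is the norm of some [beta] in [Z[zeta_8]], so that the relative
norm of [q = (1 - zeta_8) beta] has norm [2 p], which pins its coordinates down
to [+-(a + b)] and [+-(a - b)]. All three representations of [p] come from
Thue's pigeonhole lemma. *)

(** * Circulant determinants and roots of unity *)

(** The Vandermonde matrix of the powers of [z] diagonalises the circulant, and it is invertible
    because these powers are distinct. *)
Lemma det_circulant (F : fieldType) (n : nat) (a : 'I_n.+1 -> F) (z : F) :
  (n.+1).-primitive_root z ->
  \det (circulant a) = \prod_(k < n.+1) \sum_(i < n.+1) a i * (z ^+ k) ^+ i.
Proof.
move=> z_prim.
pose V := (Vandermonde n.+1 (\row_(k < n.+1) z ^+ k))^T.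
pose d := \row_(k < n.+1) \sum_(i < n.+1) a i * (z ^+ k) ^+ i.
have VC : V *m circulant a = diag_mx d *m V.
  apply/matrixP => k j; rewrite mul_diag_mx !mxE mulr_suml.
  rewrite (reindex_inj (addIr j)); apply: eq_bigr => i _.
  rewrite !mxE addrK mulrC -mulrA -exprD; congr (_ * _).
  rewrite -!exprM; apply/eqP; rewrite (eq_prim_root_expr z_prim) /=.
  by rewrite modnMmr.
have V_neq0 : \det V != 0.
  rewrite det_tr det_Vandermonde prodf_seq_neq0; apply/allP => i _ /=.
  rewrite prodf_seq_neq0; apply/allP => j _; apply/implyP => ltij.
  rewrite !mxE subr_eq0 (eq_prim_root_expr z_prim) !modn_small ?ltn_ord //.
  by rewrite gtn_eqF.
apply: (mulfI V_neq0); rewrite -det_mulmx VC det_mulmx det_diag mulrC.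
by congr (_ * _); apply: eq_bigr => k _; rewrite mxE.
Qed.

Lemma D_horner (s : seq int) (z : algC) : (size s <= 16)%N ->
  16.-primitive_root z ->
  (D (fun i : 'I_16 => s`_i))%:~R =
    \prod_(k < 16) horner_rec (map intr s) (z ^+ k) :> algC.
Proof.
move=> s_le16 z_prim; rewrite /D -det_map_mx.
have -> : map_mx intr (circulant (fun i : 'I_16 => s`_i)) =
          circulant (fun i : 'I_16 => (s`_i)%:~R : algC).
  by apply/matrixP => i j; rewrite !mxE.
rewrite (det_circulant _ _ _ _ z_prim); apply: eq_bigr => k _.
rewrite -horner_Poly (@horner_coef_wide _ 16); last first.
  by rewrite (leq_trans (size_Poly _)) ?size_map.
apply: eq_bigr => i _; rewrite coef_Poly; congr (_ * _).
have [lt_i|le_i] := ltnP i (size s); first by rewrite (nth_map 0).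
by rewrite !nth_default ?size_map.
Qed.

(** The roots are grouped by order and paired as [y], [- y], so that each pair yields a relative
    norm. *)
Lemma prod_unity_root16 (R : comNzRingType) (f : R -> R) (z : R) : z ^+ 8 = -1 ->
  \prod_(k < 16) f (z ^+ k) =
    f 1 * f (-1) * (f (z ^+ 4) * f (- z ^+ 4)) *
    (f (z ^+ 2) * f (- z ^+ 2) * (f (z ^+ 6) * f (- z ^+ 6))) *
    (f z * f (- z) * (f (z ^+ 3) * f (- z ^+ 3)) *
     (f (z ^+ 5) * f (- z ^+ 5) * (f (z ^+ 7) * f (- z ^+ 7)))).
Proof.
move=> z8; have zN k : z ^+ (8 + k) = - z ^+ k by rewrite exprD z8 mulN1r.
rewrite !big_ord_recl big_ord0 /= /bump /=.
rewrite (zN 0) (zN 1) (zN 2) (zN 3) (zN 4) (zN 5) (zN 6) (zN 7) expr0 expr1.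
set f0 := f 1; set f8 := f (- 1); ring.
Qed.



(* With zeta a primitive 8th root of unity, [q0 + q1 zeta + q2 zeta^2 + q3 zeta^3]
   times its conjugate under [zeta |-> - zeta] is [rnorm_re + rnorm_im * i]. *)
Definition rnorm_re (q0 q1 q2 q3 : int) : int := q0 ^+ 2 - q2 ^+ 2 + 2 * q1 * q3.
Definition rnorm_im (q0 q1 q2 q3 : int) : int := 2 * q0 * q2 - q1 ^+ 2 + q3 ^+ 2.
Definition qnorm (q0 q1 q2 q3 : int) : int :=
  rnorm_re q0 q1 q2 q3 ^+ 2 + rnorm_im q0 q1 q2 q3 ^+ 2.

(** [f] is the polynomial of [s] in unexpanded form. The product of [1 - y] over the primitive 16th
    roots is 2; with [f 1 * f (-1) = 8] this gives the factor 16. *)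
Lemma S16_prod (s : seq int) (u v q0 q1 q2 q3 : int)
    (f : algC -> algC) :
    (size s <= 16)%N -> (forall y, horner_rec (map intr s) y = f y) ->
    f 1 * f (-1) = 8 ->
    (forall y : algC, y ^+ 2 = -1 -> f y = u%:~R + v%:~R * y) ->
    (forall y : algC, y ^+ 4 = -1 ->
       f y = q0%:~R + q1%:~R * y + q2%:~R * y ^+ 2 + q3%:~R * y ^+ 3) ->
    (forall y : algC, y ^+ 8 = -1 -> f y = 1 - y) ->
  S16 (16 * (u ^+ 2 + v ^+ 2) * qnorm q0 q1 q2 q3).
Proof.
move=> s_le16 fE h1 h2 h4 h8; exists (fun i : 'I_16 => s`_i); apply: (@intr_inj algC).
have [z z_prim] := C_prim_root_exists (isT : (0 < 16)%N).
have z8 : z ^+ 8 = -1.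
  have /eqP : (z ^+ 8) ^+ 2 = 1 by rewrite -exprM (prim_expr_order z_prim).
  by rewrite sqrf_eq1 -(prim_order_dvd z_prim) /= => /eqP.
have z8k k : odd k -> (z ^+ k) ^+ 8 = -1.
  by move=> k_odd; rewrite -exprM mulnC exprM z8 -signr_odd k_odd.
have f8 (y : algC) : y ^+ 8 = -1 -> f y * f (- y) = 1 - y ^+ 2.
  by move=> y8; rewrite (h8 y) // (h8 (- y)) ?sqrrN; [ring | rewrite exprNn y8; ring].
have f4 (y : algC) : y ^+ 4 = -1 ->
    f y * f (- y) = (rnorm_re q0 q1 q2 q3)%:~R + (rnorm_im q0 q1 q2 q3)%:~R * y ^+ 2.
  move=> y4; rewrite (h4 y) // (h4 (- y)); last by rewrite exprNn y4; ring.
  rewrite /rnorm_re /rnorm_im.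
  by ring: y4.
have f2 (y : algC) : y ^+ 2 = -1 -> f y * f (- y) = (u ^+ 2 + v ^+ 2)%:~R.
  move=> y2; rewrite (h2 y) // (h2 (- y)); [ring: y2 | rewrite sqrrN y2; ring].
rewrite (D_horner _ _ s_le16 z_prim) (eq_bigr _ (fun k _ => fE _)).
rewrite prod_unity_root16 // h1.
rewrite f2 -?exprM // f4 -?exprM // f4; last first.
  by rewrite -exprM (exprM z 8 3) z8; ring.
rewrite f8 // (f8 (z ^+ 3)) ?z8k // (f8 (z ^+ 5)) ?z8k // (f8 (z ^+ 7)) ?z8k //.
rewrite /qnorm; move: (rnorm_re _ _ _ _) (rnorm_im _ _ _ _) => re im.
by ring: z8.
Qed.

Lemma S16_fourth_root (m n : int) : S16 (32 * ((3 + 8 * m) ^+ 2 + (1 + 8 * n) ^+ 2)).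
Proof.
pose s : seq int := [:: - m; - 1 - n; m; n; - 1 - m; - n; m; n; - 1 - m; - n; m; n;
  - 1 - m; - n; m; n].
pose f (y : algC) := - (y + y ^+ 4 + y ^+ 8 + y ^+ 12) +
  (m%:~R + n%:~R * y) * ((y ^+ 2 - 1) * (y ^+ 4 + 1) * (y ^+ 8 + 1)).
have fE y : horner_rec (map intr s) y = f y by rewrite /f /=; ring.
(* The coordinates [1, -1, 0, 0] are those of [1 - zeta_8], whose norm 2 turns 16 into 32. *)
have := @S16_prod s (- (3 + 8 * m)) (- (1 + 8 * n)) 1 (-1) 0 0 f isT fE.
rewrite (_ : 16 * _ * _ = 32 * ((3 + 8 * m) ^+ 2 + (1 + 8 * n) ^+ 2)); last first.
  by rewrite /qnorm /rnorm_re /rnorm_im; ring.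
by apply; rewrite /f {f fE}; [ring | move=> y yP; ring: yP..].
Qed.

Lemma S16_eighth_root (k0 k1 k2 k3 : int) :
  S16 (32 * qnorm (1 - 4 * k0) (1 - 4 * k1) (2 - 4 * k2) (- 4 * k3)).
Proof.
pose s : seq int := [:: 1 - k0; - k1; 1 - k2; - k3; k0; k1; k2; k3;
  - k0; 1 - k1; 1 - k2; - k3; k0; k1; k2; k3].
pose f (y : algC) := 1 + y ^+ 2 + y ^+ 9 + y ^+ 10 +
  (k0%:~R + k1%:~R * y + k2%:~R * y ^+ 2 + k3%:~R * y ^+ 3) *
  ((y ^+ 4 - 1) * (y ^+ 8 + 1)).
have fE y : horner_rec (map intr s) y = f y by rewrite /f /=; ring.
have := @S16_prod s (-1) 1 (1 - 4 * k0) (1 - 4 * k1) (2 - 4 * k2) (- 4 * k3) f isT fE.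
rewrite (_ : 16 * ((-1) ^+ 2 + 1 ^+ 2) = 32) //.
by apply; rewrite /f {f fE}; [ring | move=> y yP; ring: yP..].
Qed.

(** * Symmetries of the norm of [Z[zeta_8]] *)

Lemma int_parity (x : int) : exists k : int, x = 2 * k \/ x = 2 * k + 1.
Proof. exists (x %/ 2)%Z; lia. Qed.

Lemma even_pronic (x : int) : exists k : int, x ^+ 2 + x = 2 * k.
Proof.
have [k [->|->]] := int_parity x; first by exists (2 * k ^+ 2 + k); ring.
by exists (2 * k ^+ 2 + 3 * k + 1); ring.
Qed.

(* [rot] is multiplication by zeta, [gal] the automorphism zeta |-> zeta^3. *)
Lemma rnorm_re_rot q0 q1 q2 q3 : rnorm_re (- q3) q0 q1 q2 = rnorm_im q0 q1 q2 q3.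
Proof. by rewrite /rnorm_re /rnorm_im; ring. Qed.

Lemma rnorm_im_rot q0 q1 q2 q3 : rnorm_im (- q3) q0 q1 q2 = - rnorm_re q0 q1 q2 q3.
Proof. by rewrite /rnorm_re /rnorm_im; ring. Qed.

Lemma qnorm_rot q0 q1 q2 q3 : qnorm (- q3) q0 q1 q2 = qnorm q0 q1 q2 q3.
Proof. by rewrite /qnorm rnorm_re_rot rnorm_im_rot; ring. Qed.

Lemma rnorm_re_gal q0 q1 q2 q3 : rnorm_re q0 q3 (- q2) q1 = rnorm_re q0 q1 q2 q3.
Proof. by rewrite /rnorm_re; ring. Qed.

Lemma rnorm_im_gal q0 q1 q2 q3 : rnorm_im q0 q3 (- q2) q1 = - rnorm_im q0 q1 q2 q3.
Proof. by rewrite /rnorm_im; ring. Qed.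

Lemma qnorm_gal q0 q1 q2 q3 : qnorm q0 q3 (- q2) q1 = qnorm q0 q1 q2 q3.
Proof. by rewrite /qnorm rnorm_re_gal rnorm_im_gal; ring. Qed.

Lemma pm3_mod8N x : pm3_mod8 x -> pm3_mod8 (- x).
Proof. by case=> m mP; exists (- m); lia. Qed.

(** The norm is kept by negating all coordinates, and by zeta |-> - zeta, which negates the second
    and fourth. Together these make both odd coordinates 1 mod 4, while 2 and 0 mod 4 are
    insensitive to sign. *)
Lemma S16_qnorm_odd_odd_2_0 (a b c d : int) :
  S16 (32 * qnorm (2 * a + 1) (2 * b + 1) (4 * c + 2) (4 * d)).
Proof.
have [i [->|->]] := int_parity a; have [j [->|->]] := int_parity b.
- rewrite (_ : qnorm _ _ _ _ =
    qnorm (1 - 4 * (- i)) (1 - 4 * (- j)) (2 - 4 * (- c)) (- 4 * (- d))).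
    exact: S16_eighth_root.
  by congr qnorm; ring.
- rewrite (_ : qnorm _ _ _ _ =
    qnorm (1 - 4 * (- i)) (1 - 4 * (j + 1)) (2 - 4 * (- c)) (- 4 * d)).
    exact: S16_eighth_root.
  by rewrite /qnorm /rnorm_re /rnorm_im; ring.
- rewrite (_ : qnorm _ _ _ _ =
    qnorm (1 - 4 * (i + 1)) (1 - 4 * (- j)) (2 - 4 * (c + 1)) (- 4 * (- d))).
    exact: S16_eighth_root.
  by rewrite /qnorm /rnorm_re /rnorm_im; ring.
- rewrite (_ : qnorm _ _ _ _ =
    qnorm (1 - 4 * (i + 1)) (1 - 4 * (j + 1)) (2 - 4 * (c + 1)) (- 4 * d)).
    exact: S16_eighth_root.
  by rewrite /qnorm /rnorm_re /rnorm_im; ring.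
Qed.

(** The real part is [1 - 4 c^2 + 4 d] modulo 8, so exactly one of [c], [d] is odd. If it is [d],
    the automorphism followed by a rotation moves it to the third place. *)
Lemma S16_qnorm_odd_odd_even_even (a b c d : int) :
  pm3_mod8 (rnorm_re (2 * a + 1) (2 * b + 1) (2 * c) (2 * d)) ->
  S16 (32 * qnorm (2 * a + 1) (2 * b + 1) (2 * c) (2 * d)).
Proof.
case=> m reP; have [k kE] := even_pronic a.
have {}reP : 8 * k + 1 - 4 * c ^+ 2 + 8 * (b * d) + 4 * d = 8 * m + 3 \/
             8 * k + 1 - 4 * c ^+ 2 + 8 * (b * d) + 4 * d = 8 * m - 3.
  suff -> : 8 * k + 1 - 4 * c ^+ 2 + 8 * (b * d) + 4 * d =
    rnorm_re (2 * a + 1) (2 * b + 1) (2 * c) (2 * d) by [].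
  transitivity (4 * (2 * k) + 1 - 4 * c ^+ 2 + 8 * (b * d) + 4 * d); first by ring.
  by rewrite -kE /rnorm_re; ring.
have [i [cE|cE]] := int_parity c; have [j [dE|dE]] := int_parity d.
- by move: reP; rewrite cE dE !exprMn; lia.
- rewrite -qnorm_gal -qnorm_rot.
  rewrite (_ : qnorm _ _ _ _ =
     qnorm (2 * (- b - 1) + 1) (2 * a + 1) (4 * j + 2) (4 * (- i))).
    exact: S16_qnorm_odd_odd_2_0.
  by rewrite cE dE; congr qnorm; ring.
- have -> : 2 * c = 4 * i + 2 by rewrite cE; ring.
  have -> : 2 * d = 4 * j by rewrite dE; ring.
  exact: S16_qnorm_odd_odd_2_0.
- by move: reP; rewrite cE dE sqrrD !exprMn; lia.
Qed.

(** Oddness of the real and imaginary parts leaves exactly one odd coordinate in each of the pairs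
    [q0], [q2] and [q1], [q3]. Up to sign, two rotations exchange the members of each pair, and the
    automorphism exchanges [q1] and [q3] alone. *)
Lemma S16_qnorm (q0 q1 q2 q3 : int) :
  pm3_mod8 (rnorm_re q0 q1 q2 q3) -> pm3_mod8 (rnorm_im q0 q1 q2 q3) ->
  S16 (32 * qnorm q0 q1 q2 q3).
Proof.
have odd_even x b c y : let q0 := 2 * x + 1 in let q2 := 2 * y in
    pm3_mod8 (rnorm_re q0 b q2 c) -> pm3_mod8 (rnorm_im q0 b q2 c) ->
    S16 (32 * qnorm q0 b q2 c).
  move=> /= re3; have [i [bE|bE]] := int_parity b; have [j [cE|cE]] := int_parity c.
  - by case=> m; rewrite /rnorm_im bE cE !exprMn; lia.
  - move=> _; rewrite -qnorm_gal bE cE (_ : - (2 * y) = 2 * (- y)); last by ring.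
    apply: S16_qnorm_odd_odd_even_even.
    by rewrite -rnorm_re_gal mulrN opprK -bE -cE.
  - by move=> _; rewrite bE cE; apply: S16_qnorm_odd_odd_even_even; rewrite -bE -cE.
  - by case=> m; rewrite /rnorm_im bE cE !sqrrD !exprMn; lia.
move=> re3 im3.
have [x [xE|xE]] := int_parity q0; have [y [yE|yE]] := int_parity q2.
- by case: re3 => m; rewrite /rnorm_re xE yE !exprMn; lia.
- rewrite -qnorm_rot -qnorm_rot (_ : - q2 = 2 * (- y - 1) + 1); last by lia.
  rewrite xE; apply: odd_even.
    rewrite -xE (_ : 2 * _ + 1 = - q2); last by lia.
    by rewrite rnorm_re_rot rnorm_im_rot; apply: pm3_mod8N.
  rewrite -xE (_ : 2 * _ + 1 = - q2); last by lia.
  by rewrite rnorm_im_rot rnorm_re_rot; apply: pm3_mod8N.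
- by move: re3 im3; rewrite xE yE; apply: odd_even.
- by case: re3 => m; rewrite /rnorm_re xE yE !sqrrD !exprMn; lia.
Qed.

(** * Roots modulo [p] and Thue's lemma *)

(** Pigeonhole: more vectors with entries in [0..M] than residues modulo [p]; the difference of two
    colliding vectors is the solution. *)
Lemma thue (p n M : nat) (c : 'I_n -> int) : (0 < p < M.+1 ^ n)%N ->
  exists x : 'I_n -> int, [/\ exists i, x i != 0, forall i, `|x i| <= M%:Z &
    (p%:Z %| \sum_i c i * x i)%Z].
Proof.
case: p => // p /= p_lt.
pose F (g : {ffun 'I_n -> 'I_M.+1}) : 'I_p.+1 :=
  inord `|((\sum_i c i * (g i)%:Z) %% p.+1%:Z)%Z|.
have /injectivePn[g [h gh eqF]] : ~~ injectiveb F.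
  apply/injectiveP => /leq_card; rewrite card_ffun !card_ord; lia.
exists (fun i => (g i)%:Z - (h i)%:Z); split.
- have /eqfunP/forallPn[i gh_i] : ~ g =1 h by move/ffunP => /eqP; apply/negP.
  by exists i; move: gh_i; rewrite subr_eq0 eqz_nat.
- by move=> i; have := ltn_ord (g i); have := ltn_ord (h i); lia.
- under eq_bigr do rewrite mulrBr.
  rewrite sumrB -eqz_mod_dvd; move: eqF => /(congr1 (@nat_of_ord _)); rewrite /F.
  set a := \sum_i _; set b := \sum_i _; rewrite !inordK; lia.
Qed.

(** The lower bound is strict because a prime is not a perfect power; this makes the later bounds on
    the cofactor [k] strict. *)
Lemma root_bounds (p n : nat) : prime p -> (1 < n)%N ->
  exists M, (M ^ n < p < M.+1 ^ n)%N.
Proof.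
move=> p_pr n_gt1; have n_gt0 := ltnW n_gt1.
have ex : exists M, (p < M.+1 ^ n)%N.
  by exists p; rewrite (leq_trans (ltnSn p)) // -{1}(expn1 p.+1) leq_pexp2l.
case: (ex_minnP ex) => -[|M] p_lt minM; first by rewrite exp1n ltnNge prime_gt0 in p_lt.
exists M.+1; rewrite p_lt andbT ltn_neqAle leqNgt.
rewrite (_ : (_ < _)%N = false) ?andbT; last first.
  by apply/negbTE/negP => /minM; rewrite ltnn.
apply/eqP => pE; have /primeP[p_gt1 /(_ M.+1)] := p_pr.
rewrite -pE dvdn_exp // => /(_ isT) /orP[/eqP ME|/eqP ME].
  by rewrite -pE ME exp1n in p_gt1.
have M_gt1 : (1 < M.+1)%N by rewrite ME pE.
by move/eqP: ME; rewrite -{1}(expn1 M.+1) eqn_exp2l // => /eqP nE; rewrite -nE in n_gt1.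
Qed.

Lemma Fp_lift (p : nat) (x : 'F_p) : exists s : int, s%:~R = x.
Proof. by exists (x : nat)%:Z; rewrite -pmulrn natr_Zp. Qed.

(** With [p - 1 = 2 t m], the polynomial [X^(t m) - 1] has too few roots to kill every unit; a unit
    [x] it misses has [x^(t m) = -1], and [s] lifts [x^t]. *)
Lemma exists_expn_eqN1 (p m : nat) : prime p -> (0 < m)%N -> (2 * m %| p.-1)%N ->
  exists s : int, (p%:Z %| s ^+ m + 1)%Z.
Proof.
move=> p_pr m_gt0 /dvdnP[t pE].
have t_gt0 : (0 < t)%N by case: t pE => // pE; have := prime_gt1 p_pr; lia.
have h_gt0 : (0 < t * m)%N by rewrite muln_gt0 t_gt0.
have [x x_neq0 xh] : exists2 x : 'F_p, x != 0 & x ^+ (t * m) != 1.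
  have [/existsP[x /andP[]]|none] := boolP [exists x : 'F_p, (x != 0) && (x ^+ (t * m) != 1)].
    by exists x.
  have q_neq0 : 'X^(t * m) - 1%:P != 0 :> {poly 'F_p}.
    by rewrite -size_poly_eq0 size_XnsubC.
  suff /(max_poly_roots q_neq0) : all (root ('X^(t * m) - 1%:P)) (enum (predC1 (0 : 'F_p))).
    move/(_ (enum_uniq _)); rewrite size_XnsubC // -cardE cardC1 card_Fp // pE; lia.
  apply/allP => x; rewrite mem_enum inE => x_neq0.
  rewrite rootE !hornerE subr_eq0; apply: contraNT none => xh.
  by apply/existsP; exists x; rewrite x_neq0.
have [s sE] := Fp_lift p (x ^+ t); exists s.
rewrite (dvdz_pcharf (pchar_Fp p_pr)) rmorphD rmorphXn /= sE -exprM addr_eq0.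
have /eqP : (x ^+ (t * m)) ^+ 2 = 1.
  apply: (mulfI x_neq0); rewrite -exprM -exprS mulr1.
  rewrite (_ : (_ * _ * 2).+1 = #|'F_p|) ?expf_card // card_Fp //.
  by have := prime_gt0 p_pr; lia.
by rewrite sqrf_eq1 (negPf xh).
Qed.

Lemma dvdp_subXX (F : fieldType) (d x y : {poly F}) (n : nat) :
  d %| x - y -> d %| x ^+ n - y ^+ n.
Proof. by rewrite subrXX => /dvdp_mulr. Qed.

(* Modulo [X^4 + 1], [w = X + X^3] is a square root of -2, and for [p = 3 mod 8]
   the Frobenius fixes [w], so that [(-2)^((p - 1) / 2) = 1]. *)
Lemma exists_sqr_eqN2 (p : nat) : prime p -> (p = 3 %[mod 8])%N ->
  exists s : int, (p%:Z %| s ^+ 2 + 2)%Z.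
Proof.
move=> p_pr p3; pose k := (p %/ 8)%N; have pE : p = (8 * k + 3)%N by lia.
have pcharX : p \in [pchar {poly 'F_p}] by rewrite pchar_poly pchar_Fp.
pose d : {poly 'F_p} := 'X^4 + 1; pose w : {poly 'F_p} := 'X + 'X^3.
have X8 n : d %| 'X ^+ (8 * n) - 1.
  rewrite exprM -(expr1n _ n); apply: dvdp_subXX.
  by apply/dvdpP; exists ('X^4 - 1); rewrite /d; ring.
(* Since [p = 3] and [3 * p = 1] modulo 8, the Frobenius swaps the two terms of [w]. *)
have dvd_frob : d %| w ^+ p - w.
  rewrite /w exprDn_pchar ?pnatE // -exprM.
  rewrite (_ : _ - _ = ('X ^+ (8 * k) - 1) * 'X^3 + ('X ^+ (8 * (3 * k + 1)) - 1) * 'X).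
    by rewrite dvdp_add // dvdp_mulr.
  rewrite !mulrBl -exprD -exprSr !mul1r -pE.
  by rewrite (_ : (8 * (3 * k + 1)).+1 = 3 * p)%N; [ring | lia].
pose c : 'F_p := (- 2) ^+ (4 * k + 1).
have dvd_pow : d %| w ^+ p - c *: w.
  rewrite -mul_polyC (_ : c%:P = (-2) ^+ (4 * k + 1)); last by rewrite rmorphXn rmorphN rmorph_nat.
  rewrite (_ : w ^+ p = w ^+ (2 * (4 * k + 1)).+1); last by congr (w ^+ _); lia.
  rewrite exprSr exprM -mulrBl dvdp_mulr // dvdp_subXX //.
  by apply/dvdpP; exists ('X^2 + 2); rewrite /w /d; ring.
(* [d], of degree 4, divides [(1 - c) w], and [w] has degree 3. *)
have c1 : c = 1.
  apply/eqP; rewrite -subr_eq0; apply: contraLR (dvdp_sub dvd_pow dvd_frob) => c_neq1.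
  rewrite (_ : _ - _ = (1 - c) *: w); last first.
    by rewrite scalerBl scale1r; move: (c *: w) (w ^+ p) => *; ring.
  rewrite -opprB scaleNr dvdpNr dvdpZr //; apply/negP => /dvdp_leq.
  rewrite -size_poly_eq0 /w /d addrC !size_polyDl ?size_polyXn ?size_polyX ?size_poly1 //.
  by move=> /(_ isT).
(* The exponent is [(p + 1) / 4], so the square is [-2 * c = -2]. *)
have [s sE] := Fp_lift p ((- 2) ^+ (2 * k + 1)); exists s.
rewrite (dvdz_pcharf (pchar_Fp p_pr)) rmorphD rmorphXn /= sE -exprM.
rewrite (_ : (_ * 2 = (4 * k + 1).+1)%N); last by lia.
by rewrite exprS -/c c1 mulr1 addNr.
Qed.

(** * Representing primes by norm forms *)

Lemma sqr_le_bound (x : int) (M : nat) : `|x| <= M%:Z -> x ^+ 2 <= M%:Z ^+ 2.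
Proof. by move=> xM; rewrite -(real_normK (num_real x)) lerXn2r ?nnegrE. Qed.

(** Thue's lemma for the form [x - s y]: its solutions satisfy [x^2 = - d y^2] modulo [p], and both
    squares are below [p]. *)
Lemma repr_quadratic (p : nat) (d s : int) : prime p -> 0 < d ->
  (p%:Z %| s ^+ 2 + d)%Z ->
  exists x y k : int, x ^+ 2 + d * y ^+ 2 = k * p%:Z /\ 0 < k < 1 + d.
Proof.
move=> p_pr d_gt0 sP; have [M /andP[M_lt p_lt]] := root_bounds p 2 p_pr isT.
have [|x [[i xi] xM]] := thue p 2 M (fun i => if val i == 0%N then 1 else - s).
  by rewrite prime_gt0.
rewrite !big_ord_recl big_ord0 /= /bump /= mul1r addr0.
set a := x _; set b := x _ => ab.
have a2 := sqr_le_bound _ _ (xM _ : `|a| <= M).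
have b2 := sqr_le_bound _ _ (xM _ : `|b| <= M).
have /dvdzP[k kE] : (p%:Z %| a ^+ 2 + d * b ^+ 2)%Z.
  rewrite (_ : _ + _ = (a + - s * b) * (a + s * b) + (s ^+ 2 + d) * b ^+ 2); last by ring.
  by rewrite rpredD // dvdz_mulr.
exists a, b, k; split=> //.
have ab0 : (a != 0) || (b != 0).
  apply: contraNT xi; rewrite negb_or !negbK => /andP[/eqP a0 /eqP b0].
  case: i => -[|[|//]] i2; [rewrite -a0 | rewrite -b0]; apply/eqP; congr (x _); exact: val_inj.
have p_gt0 : 0 < p%:Z :> int by rewrite ltz_nat prime_gt0.
have Mp : M%:Z ^+ 2 < p%:Z by rewrite -rmorphXn /= ltz_nat.
have b2_ge0 := sqr_ge0 b; have a2_ge0 := sqr_ge0 a.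
apply/andP; split; last by rewrite -(ltr_pM2r p_gt0) -kE; nra.
rewrite -(pmulr_lgt0 k p_gt0) -kE; case/orP: ab0 => ab_neq0.
  by rewrite ltr_wpDr //; [rewrite mulr_ge0 // ltW | rewrite exprn_even_gt0].
by rewrite ltr_wpDl // mulr_gt0 // exprn_even_gt0.
Qed.

(** Irrationality of sqrt 2, by parity of 2-adic valuations; it serves to show that only zero has
    norm zero. *)
Lemma sqr_eq_2sqr (a b : int) : a ^+ 2 = 2 * b ^+ 2 -> a = 0.
Proof.
move=> abE; apply/eqP; apply: contra_eqT (erefl true) => a_neq0.
have b_neq0 : b != 0 by apply: contra_neq a_neq0 => b0; apply/eqP; rewrite -sqrf_eq0 abE b0.
have : (`|a| ^ 2 = 2 * `|b| ^ 2)%N by rewrite -!abszX -(abszM 2) -abE.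
move/(congr1 (logn 2)); rewrite lognM ?expn_gt0 ?absz_gt0 ?b_neq0 // !lognX.
rewrite (_ : logn 2 2 = 1)%N //; lia.
Qed.

(* The norm computed through the subfield [Q(sqrt 2)]. *)
Lemma qnormE q0 q1 q2 q3 : qnorm q0 q1 q2 q3 =
  (q0 ^+ 2 + q1 ^+ 2 + q2 ^+ 2 + q3 ^+ 2) ^+ 2 -
  2 * (q0 * q1 + q1 * q2 + q2 * q3 - q3 * q0) ^+ 2.
Proof. by rewrite /qnorm /rnorm_re /rnorm_im; ring. Qed.

(** Here [s] plays the role of zeta modulo [p]. Thue's lemma makes the value of [q] at [s] vanish
    modulo [p], hence also its norm; by [qnormE] the norm is at most the squared sum of four
    squares, below [16 p]. *)
Lemma repr_qnorm (p : nat) (s : int) : prime p -> (p%:Z %| s ^+ 4 + 1)%Z ->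
  exists q0 q1 q2 q3 k : int, qnorm q0 q1 q2 q3 = k * p%:Z /\ 0 < k < 16.
Proof.
move=> p_pr sP; have [M /andP[M_lt p_lt]] := root_bounds p 4 p_pr isT.
have [|x [[i xi] xM]] := thue p 4 M (fun i => s ^+ i).
  by rewrite prime_gt0.
rewrite !big_ord_recl big_ord0 /= /bump /= addr0.
set a := x _; set b := x _; set c := x _; set d := x _ => ad.
have a2 := sqr_le_bound _ _ (xM _ : `|a| <= M).
have b2 := sqr_le_bound _ _ (xM _ : `|b| <= M).
have c2 := sqr_le_bound _ _ (xM _ : `|c| <= M).
have d2 := sqr_le_bound _ _ (xM _ : `|d| <= M).
have /dvdzP[k kE] : (p%:Z %| qnorm a b c d)%Z.
  pose re := rnorm_re a b c d; pose im := rnorm_im a b c d.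
  have dvd_re_im : (p%:Z %| re + im * s ^+ 2)%Z.
    rewrite (_ : _ + _ = (s ^+ 0 * a + (s ^+ 1 * b + (s ^+ 2 * c + s ^+ 3 * d))) *
       (a - s * b + s ^+ 2 * c - s ^+ 3 * d) +
       (s ^+ 4 + 1) * (- c ^+ 2 + 2 * b * d + d ^+ 2 * s ^+ 2)).
      by rewrite rpredD // dvdz_mulr.
    by rewrite /re /im /rnorm_re /rnorm_im; ring.
  rewrite /qnorm -/re -/im.
  rewrite (_ : _ + _ = (re + im * s ^+ 2) * (re - im * s ^+ 2) + (s ^+ 4 + 1) * im ^+ 2).
    by rewrite rpredD // dvdz_mulr.
  by ring.
exists a, b, c, d, k; split=> //.
have p_gt0 : 0 < p%:Z :> int by rewrite ltz_nat prime_gt0.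
have Mp : M%:Z ^+ 4 < p%:Z by rewrite -rmorphXn /= ltz_nat.
apply/andP; split; last first.
  rewrite -(ltr_pM2r p_gt0) -kE qnormE; set E := a ^+ 2 + _ + _ + _; set F := a * b + _ + _ - _.
  have E_ge0 : 0 <= E by rewrite !addr_ge0 ?exprn_even_ge0.
  have E_le : E <= 4 * M%:Z ^+ 2.
    rewrite /E (_ : 4 * _ = M%:Z ^+ 2 + M%:Z ^+ 2 + M%:Z ^+ 2 + M%:Z ^+ 2); last by ring.
    by rewrite !lerD.
  have : E ^+ 2 <= (4 * M%:Z ^+ 2) ^+ 2.
    by rewrite lerXn2r ?nnegrE // mulr_ge0 ?exprn_even_ge0.
  rewrite (_ : (4 * M%:Z ^+ 2) ^+ 2 = 16 * M%:Z ^+ 4); last by ring.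
  move: (E ^+ 2) (F ^+ 2) (sqr_ge0 F) (M%:Z ^+ 4) Mp => e f f_ge0 m m_lt.
  by clear - f_ge0 m_lt => le_em; lia.
rewrite -(pmulr_lgt0 k p_gt0) -kE.
rewrite lt_neqAle /qnorm addr_ge0 ?exprn_even_ge0 // andbT eq_sym -/(qnorm _ _ _ _).
apply: contraNneq xi => q_eq0.
have : a ^+ 2 + b ^+ 2 + c ^+ 2 + d ^+ 2 = 0.
  by apply: (sqr_eq_2sqr _ (a * b + b * c + c * d - d * a)); apply/eqP; rewrite -subr_eq0 -qnormE q_eq0.
move/eqP; rewrite !paddr_eq0 ?addr_ge0 ?exprn_even_ge0 // !sqrf_eq0.
move=> /andP[/andP[/andP[/eqP a0 /eqP b0] /eqP c0] /eqP d0].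
case: i => -[|[|[|[|//]]]] i4; [rewrite -a0 | rewrite -b0 | rewrite -c0 | rewrite -d0];
  by apply/eqP; congr (x _); apply: val_inj.
Qed.

(* Multiplication by [1 - zeta]. *)
Lemma qnorm_mul_1subz c0 c1 c2 c3 :
  qnorm (c0 + c3) (c1 - c0) (c2 - c1) (c3 - c2) = 2 * qnorm c0 c1 c2 c3.
Proof. by rewrite /qnorm /rnorm_re /rnorm_im; ring. Qed.

(** The sum of the coordinates is the value at zeta = 1: if it is even, [q] is divisible by
    [1 - zeta]. Otherwise [qnormE] reads [E^2 - 2 F^2] with [E] odd and [F] even. *)
Lemma qnorm_parity q0 q1 q2 q3 :
  (exists c0 c1 c2 c3, qnorm q0 q1 q2 q3 = 2 * qnorm c0 c1 c2 c3) \/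
  (exists m, qnorm q0 q1 q2 q3 = 8 * m + 1).
Proof.
have [t [tE|tE]] := int_parity (q0 + q1 + q2 + q3); [left | right].
  exists (q0 - t), (q0 + q1 - t), (t - q3), t.
  by rewrite -qnorm_mul_1subz; congr qnorm; lia.
rewrite qnormE; set E := q0 ^+ 2 + _ + _ + _; set F := q0 * q1 + _ + _ - _.
have [e eE] : exists e, E = 2 * e + 1.
  have [k0 k0E] := even_pronic q0; have [k1 k1E] := even_pronic q1.
  have [k2 k2E] := even_pronic q2; have [k3 k3E] := even_pronic q3.
  exists (k0 + k1 + k2 + k3 - t - 1).
  rewrite (_ : E = (q0 ^+ 2 + q0) + (q1 ^+ 2 + q1) + (q2 ^+ 2 + q2) + (q3 ^+ 2 + q3) -
    (q0 + q1 + q2 + q3)); last by rewrite /E; ring.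
  by rewrite k0E k1E k2E k3E tE; ring.
have [f fE] : exists f, F = 2 * f.
  rewrite (_ : F = (q0 + q2) * (q1 + q3) - 2 * (q0 * q3)); last by rewrite /F; ring.
  have [a [aE|aE]] := int_parity (q0 + q2).
    by exists (a * (q1 + q3) - q0 * q3); rewrite aE; ring.
  exists ((q0 + q2) * (t - a) - q0 * q3).
  by rewrite (_ : q1 + q3 = 2 * (t - a)); [ring | lia].
have [g gE] := even_pronic e; exists (g - f ^+ 2).
transitivity (4 * (e ^+ 2 + e) + 1 - 8 * f ^+ 2); first by rewrite eE fE; ring.
by rewrite gE; ring.
Qed.

(* Multiplication by [1 + e (zeta + zeta^3)], where [(zeta + zeta^3)^2 = -2]. *)
Lemma qnorm_mul_sqrtN2 q0 q1 q2 q3 (e : int) :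
  qnorm (q0 - e * (q1 + q3)) (q1 + e * (q0 - q2)) (q2 + e * (q1 - q3)) (q3 + e * (q0 + q2)) =
  (1 + 2 * e ^+ 2) ^+ 2 * qnorm q0 q1 q2 q3.
Proof. by rewrite /qnorm /rnorm_re /rnorm_im; ring. Qed.

Lemma intr_qnorm (R : comNzRingType) q0 q1 q2 q3
    (x0 := q0%:~R : R) (x1 := q1%:~R : R) (x2 := q2%:~R : R) (x3 := q3%:~R : R) :
  (qnorm q0 q1 q2 q3)%:~R = (x0 ^+ 2 - x2 ^+ 2 + 2 * x1 * x3) ^+ 2 +
    (2 * x0 * x2 - x1 ^+ 2 + x3 ^+ 2) ^+ 2.
Proof. by rewrite /qnorm /rnorm_re /rnorm_im /x0 /x1 /x2 /x3; ring. Qed.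

(** Some factor [1 - e sqrt(-2)] of 3, with [e = 1] or [e = -1], divides [q], as enumeration over
    ['F_3] shows. Then [q (1 + e sqrt(-2)) = 3 c], and taking norms gives [9 N(q) = 81 N(c)]. *)
Lemma qnorm_dvd3 q0 q1 q2 q3 : (3 %| qnorm q0 q1 q2 q3)%Z ->
  exists c0 c1 c2 c3, qnorm q0 q1 q2 q3 = 9 * qnorm c0 c1 c2 c3.
Proof.
have dvd3 x : (3 %| x)%Z = (x%:~R == 0 :> 'F_3) by apply: dvdz_pcharf; apply: pchar_Fp.
have F3 : forall x0 x1 x2 x3 : 'F_3,
    (x0 ^+ 2 - x2 ^+ 2 + 2 * x1 * x3) ^+ 2 + (2 * x0 * x2 - x1 ^+ 2 + x3 ^+ 2) ^+ 2 == 0 ->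
  exists2 e : int, e ^+ 2 = 1 &
    [&& x0 - e%:~R * (x1 + x3) == 0, x1 + e%:~R * (x0 - x2) == 0,
        x2 + e%:~R * (x1 - x3) == 0 & x3 + e%:~R * (x0 + x2) == 0].
  by do 4![case=> [[|[|[|//]]] ?] //] => _; first [by exists 1 | by exists (-1)].
rewrite dvd3 intr_qnorm => /F3[e e2 /and4P[c0P c1P c2P c3P]].
have /dvdzP[c0 c0E] : (3 %| (q0 - e * (q1 + q3))%R)%Z by rewrite dvd3 !(rmorphB, rmorphM, rmorphD).
have /dvdzP[c1 c1E] : (3 %| (q1 + e * (q0 - q2))%R)%Z by rewrite dvd3 !(rmorphB, rmorphM, rmorphD).
have /dvdzP[c2 c2E] : (3 %| (q2 + e * (q1 - q3))%R)%Z by rewrite dvd3 !(rmorphB, rmorphM, rmorphD).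
have /dvdzP[c3 c3E] : (3 %| (q3 + e * (q0 + q2))%R)%Z by rewrite dvd3 !(rmorphB, rmorphM, rmorphD).
exists c0, c1, c2, c3; apply: (mulfI (isT : 9 != 0 :> int)).
transitivity ((1 + 2 * e ^+ 2) ^+ 2 * qnorm q0 q1 q2 q3); first by rewrite e2.
rewrite -qnorm_mul_sqrtN2 c0E c1E c2E c3E /qnorm /rnorm_re /rnorm_im.
by ring.
Qed.

(* Start from [N(q) = k p] with [k < 16]. Dividing [q] by [1 - zeta] makes [k]
   odd, hence [k = 1 mod 8]; if [k = 9], divide by [1 + sqrt(-2)] or its conjugate. *)
Lemma prime_qnorm (p : nat) : prime p -> (p = 1 %[mod 8])%N ->
  exists q0 q1 q2 q3, qnorm q0 q1 q2 q3 = p%:Z.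
Proof.
move=> p_pr p1.
have [|s sP] := exists_expn_eqN1 p 4 p_pr isT; first by lia.
have [q0 [q1 [q2 [q3 [k [qE k_lt16]]]]]] := repr_qnorm p s p_pr sP.
pose r : int := (p %/ 8)%N; have pE : p%:Z = 8 * r + 1 by lia.
elim: {k}`|k|%N {-2}k (leqnn `|k|%N) q0 q1 q2 q3 qE k_lt16 => [|n IHn] k; first by lia.
move=> le_kn q0 q1 q2 q3 qE /andP[k_gt0 k_lt16].
have [[c0 [c1 [c2 [c3 cE]]]]|[m mE]] := qnorm_parity q0 q1 q2 q3.
  (* As [p = 8 r + 1], the cofactor [k] agrees with the norm modulo 8. *)
  have kE : k = 2 * (qnorm c0 c1 c2 c3 - 4 * (k * r)).
    transitivity (k * p%:Z - 8 * (k * r)); first by rewrite pE; ring.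
    by rewrite -qE cE; ring.
  move: (_ - 4 * _) kE => j kE.
  apply: (IHn j _ c0 c1 c2 c3); [lia | | lia].
  by apply: (mulfI (isT : 2 != 0 :> int)); rewrite -cE qE kE mulrA.
have kE : k = 8 * (m - k * r) + 1.
  transitivity (k * p%:Z - 8 * (k * r)); first by rewrite pE; ring.
  by rewrite -qE mE; ring.
move: (m - _) kE => j kE.
have [k1|k9] : k = 1 \/ k = 9 by lia.
  by exists q0, q1, q2, q3; rewrite qE k1 mul1r.
have [|c0 [c1 [c2 [c3 cE]]]] := qnorm_dvd3 q0 q1 q2 q3.
  by rewrite qE k9 dvdz_mulr.
exists c0, c1, c2, c3.
by apply: (mulfI (isT : 9 != 0 :> int)); rewrite -cE qE k9.
Qed.

Lemma sqr_add_sqr_eq4 (k l : int) : k ^+ 2 + l ^+ 2 = 4 ->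
  k = 0 /\ l ^+ 2 = 4 \/ l = 0 /\ k ^+ 2 = 4.
Proof.
have bound x y : x ^+ 2 + y ^+ 2 = 4 -> `|x| <= 2 :> int.
  move=> xyE; rewrite -(ler_sqr (normr_ge0 x) (isT : 0 <= 2 :> int)).
  by rewrite real_normK ?num_real //; have := sqr_ge0 y; lia.
move=> kl; have k2 := bound _ _ kl; have l2 : `|l| <= 2 by apply: (bound l k); rewrite addrC.
have : k = -2 \/ k = -1 \/ k = 0 \/ k = 1 \/ k = 2 by lia.
have : l = -2 \/ l = -1 \/ l = 0 \/ l = 1 \/ l = 2 by lia.
by case=> [|[|[|[|]]]] lE [|[|[|[|]]]] kE; move: kl; rewrite lE kE;
  first [by [] | by left | by right].
Qed.

(** Up to the sign of [y], [p] divides [x v - y u]. By Brahmagupta's identity it divides [x u + y v]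
    too, and the quotients satisfy [k^2 + l^2 = 4], so one of them is 0. *)
Lemma two_squares_unique (p : nat) (x y u v : int) : prime p ->
  x ^+ 2 + y ^+ 2 = 2 * p%:Z -> u ^+ 2 + v ^+ 2 = 2 * p%:Z ->
  x ^+ 2 = u ^+ 2 \/ x ^+ 2 = v ^+ 2.
Proof.
move=> p_pr; have p_gt0 : 0 < p%:Z :> int by rewrite ltz_nat prime_gt0.
wlog dvd_p : y / (p%:Z %| x * v - y * u)%Z.
  move=> IH xy uv; have : (p%:Z %| (x * v - y * u) * (x * v - - y * u))%Z.
    apply/dvdzP; exists (2 * (x ^+ 2 - u ^+ 2)).
    rewrite (_ : _ * _ = x ^+ 2 * v ^+ 2 - y ^+ 2 * u ^+ 2); last by ring.
    have -> : v ^+ 2 = 2 * p%:Z - u ^+ 2 by rewrite -uv; ring.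
    have -> : y ^+ 2 = 2 * p%:Z - x ^+ 2 by rewrite -xy; ring.
    by ring.
  rewrite dvdzE abszM Euclid_dvdM // => /orP[dvd_p|dvd_p]; first exact: (IH y).
  by apply: (IH (- y)); rewrite ?sqrrN.
move=> xy uv; have /dvdzP[k kE] := dvd_p.
pose w := x * u + y * v.
have wE : w ^+ 2 = (4 - k ^+ 2) * p%:Z ^+ 2.
  rewrite (_ : w ^+ 2 = (x ^+ 2 + y ^+ 2) * (u ^+ 2 + v ^+ 2) - (x * v - y * u) ^+ 2).
    by rewrite kE xy uv; ring.
  by rewrite /w; ring.
have /dvdzP[l lE] : (p%:Z %| w)%Z.
  by rewrite -(dvdz_pexp2r _ _ (isT : 0 < 2)%N) wE dvdz_mull.
have kl : k ^+ 2 + l ^+ 2 = 4.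
  apply: (mulIf (lt0r_neq0 (exprn_gt0 2 p_gt0))).
  transitivity (k ^+ 2 * p%:Z ^+ 2 + w ^+ 2); [by rewrite lE; ring | by rewrite wE; ring].
have xE : 2 * x = u * l + v * k.
  apply: (mulIf (lt0r_neq0 p_gt0)); transitivity (x * (2 * p%:Z)); first by ring.
  transitivity (u * (l * p%:Z) + v * (k * p%:Z)); last by ring.
  by rewrite -uv -lE -kE /w; ring.
have x2E : 4 * x ^+ 2 = (u * l + v * k) ^+ 2 by rewrite -xE; ring.
have [[k0 l2]|[l0 k2]] := sqr_add_sqr_eq4 _ _ kl; [left | right];
  apply: (mulfI (isT : 4 != 0 :> int)); rewrite x2E.
  by transitivity (u ^+ 2 * l ^+ 2); [rewrite k0; ring | rewrite l2 mulrC].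
by transitivity (v ^+ 2 * k ^+ 2); [rewrite l0; ring | rewrite k2 mulrC].
Qed.

(** * Determinants [64 p] and [64 p^2] *)

Lemma pm3_mod8_sqr (x u : int) : x ^+ 2 = u ^+ 2 -> pm3_mod8 u -> pm3_mod8 x.
Proof. by move/eqP; rewrite eqf_sqr => /orP[/eqP->|/eqP->] // /pm3_mod8N. Qed.

Lemma S16_fourth_root_pm (u v : int) : pm3_mod8 u -> (exists n, `|v| = `|8 * n + 1|) ->
  S16 (32 * (u ^+ 2 + v ^+ 2)).
Proof.
move=> [m u3] [n v1]; have -> : v ^+ 2 = (1 + 8 * n) ^+ 2.
  by rewrite -(real_normK (num_real v)) v1 real_normK ?num_real // addrC.
case: u3 => ->; first by rewrite addrC [_ + 3]addrC addrC; apply: S16_fourth_root.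
rewrite (_ : (8 * m - 3) ^+ 2 = (3 + 8 * (- m)) ^+ 2); last by ring.
exact: S16_fourth_root.
Qed.

Lemma odd_mod8 (x : int) : pm3_mod8 (2 * x + 1) \/ exists n, `|2 * x + 1| = `|8 * n + 1|.
Proof.
have [k xk] : exists k, x = 4 * k \/ x = 4 * k + 1 \/ x = 4 * k + 2 \/ x = 4 * k + 3.
  by exists (x %/ 4)%Z; lia.
case: xk => [->|[->|[->|->]]].
- by right; exists k; congr `|_|; lia.
- by left; exists k; lia.
- by left; exists (k + 1); lia.
- by right; exists (- k - 1); rewrite -normrN; congr `|_|; lia.
Qed.

(** Odd squares are 1 or 9 modulo 16, according to whether the root is +-1 or +-3 modulo 8. Since
    [2 p = 10] modulo 16, [a + b] and [a - b] are of different types. *)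
Lemma S16_5mod8 (p : nat) : prime p -> (p = 5 %[mod 8])%N -> S16 (64 * p%:Z).
Proof.
move=> p_pr p5; have [|s sP] := exists_expn_eqN1 p 2 p_pr isT; first by lia.
have [a [b [k [ab k_bd]]]] := repr_quadratic p 1 s p_pr isT sP.
have {k_bd}k1 : k = 1 by lia.
have {}ab : a ^+ 2 + b ^+ 2 = p by rewrite -(mul1r (b ^+ 2)) ab k1 mul1r.
have -> : 64 * p%:Z = 32 * ((a + b) ^+ 2 + (a - b) ^+ 2) by rewrite -ab; ring.
pose r : int := (p %/ 8)%N; have pE : p%:Z = 8 * r + 5 by lia.
have [x [xE|xE]] := int_parity (a + b).
  have [y [aE|aE]] := int_parity a; move: ab; rewrite pE.
    by rewrite (_ : b = 2 * (x - y)) ?aE ?exprMn; lia.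
  by rewrite (_ : b = 2 * (x - y) - 1) ?aE ?sqrrD ?sqrrB ?exprMn; lia.
have yE : a - b = 2 * (a - x - 1) + 1 by lia.
have ab2 : (a + b) ^+ 2 + (a - b) ^+ 2 = 2 * p%:Z by rewrite -ab; ring.
have sqr1 z : (exists n : int, `|z| = `|8 * n + 1|) -> exists m, z ^+ 2 = 16 * m + 1.
  case=> n zE; exists (4 * n ^+ 2 + n); rewrite -real_normK ?num_real // zE.
  by rewrite real_normK ?num_real //; ring.
have sqr3 z : pm3_mod8 z -> exists m, z ^+ 2 = 16 * m + 9.
  by case=> n [->|->]; [exists (4 * n ^+ 2 + 3 * n) | exists (4 * n ^+ 2 - 3 * n)]; ring.
move: ab2; rewrite pE xE yE.
have [u3|u1] := odd_mod8 x; have [v3|v1] := odd_mod8 (a - x - 1).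
- have [m ->] := sqr3 _ u3; have [n ->] := sqr3 _ v3; lia.
- by move=> _; apply: S16_fourth_root_pm.
- by move=> _; rewrite addrC; apply: S16_fourth_root_pm.
- have [m ->] := sqr1 _ u1; have [n ->] := sqr1 _ v1; lia.
Qed.

Lemma S16_3mod8 (p : nat) : prime p -> (p = 3 %[mod 8])%N -> S16 (64 * p%:Z ^+ 2).
Proof.
move=> p_pr p3; have [s sP] := exists_sqr_eqN2 p p_pr p3.
have [x [y [k [xy k_bd]]]] := repr_quadratic p 2 s p_pr isT sP.
have [c [d cd]] : exists c d, p%:Z = c ^+ 2 + 2 * d ^+ 2.
  have [k1|k2] : k = 1 \/ k = 2 by lia.
    by exists x, y; rewrite xy k1 mul1r.
  (* From [x^2 + 2 y^2 = 2 p], [x = 2 z] and [p = y^2 + 2 z^2]. *)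
  have [z [xE|xE]] := int_parity x.
    exists y, z; apply: (mulfI (isT : 2 != 0 :> int)).
    by transitivity (k * p%:Z); [rewrite k2 | rewrite -xy xE; ring].
  by move: xy; rewrite k2 xE sqrrD exprMn; lia.
have pm3_p : pm3_mod8 p by exists (p %/ 8)%N%:Z; left; lia.
(* These are the coordinates of [(1 - zeta) (c + d (zeta + zeta^3))]. *)
have reE : rnorm_re (c + d) (d - c) (- d) d = p by rewrite /rnorm_re cd; ring.
have imE : rnorm_im (c + d) (d - c) (- d) d = - p%:Z by rewrite /rnorm_im cd; ring.
have -> : 64 * p%:Z ^+ 2 = 32 * qnorm (c + d) (d - c) (- d) d.
  by rewrite /qnorm reE imE; ring.
by apply: S16_qnorm; rewrite ?reE ?imE //; apply: pm3_mod8N.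
Qed.

Lemma S16_1mod8 (p : nat) (a b : int) :
  prime p -> p%:Z = a ^+ 2 + b ^+ 2 -> (p = 1 %[mod 8])%N ->
  pm3_mod8 (a + b) -> pm3_mod8 (a - b) -> S16 (64 * p%:Z).
Proof.
move=> p_pr pE p1 apb amb; have [c0 [c1 [c2 [c3 cE]]]] := prime_qnorm p p_pr p1.
have := qnorm_mul_1subz c0 c1 c2 c3; rewrite cE.
move: (c0 + c3) (c1 - c0) (c2 - c1) (c3 - c2) => q0 q1 q2 q3 qE.
have ab2 : (a + b) ^+ 2 + (a - b) ^+ 2 = 2 * p%:Z by rewrite pE; ring.
have ba2 : (a - b) ^+ 2 + (a + b) ^+ 2 = 2 * p%:Z by rewrite pE; ring.
have -> : 64 * p%:Z = 32 * qnorm q0 q1 q2 q3 by rewrite qE; ring.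
have imE u v : u ^+ 2 + v ^+ 2 = 2 * p%:Z -> rnorm_re q0 q1 q2 q3 ^+ 2 = u ^+ 2 ->
    rnorm_im q0 q1 q2 q3 ^+ 2 = v ^+ 2.
  by move=> uv reE; apply: (addrI (u ^+ 2)); rewrite uv -qE /qnorm reE.
have [reE|reE] := two_squares_unique _ _ _ _ _ p_pr qE ab2.
  by apply: S16_qnorm; [apply: pm3_mod8_sqr reE _ | apply: pm3_mod8_sqr (imE _ _ ab2 reE) _].
by apply: S16_qnorm; [apply: pm3_mod8_sqr reE _ | apply: pm3_mod8_sqr (imE _ _ ba2 reE) _].
Qed.

Theorem theorem5p1 :
  (forall p : nat, prime p -> (p = 5 %[mod 8])%N -> S16 (64 * p%:Z)) /\
  (forall p : nat, prime p -> (p = 3 %[mod 8])%N -> S16 (64 * p%:Z ^+ 2)) /\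
  (forall (p : nat) (a b : int),
      prime p -> p%:Z = a ^+ 2 + b ^+ 2 -> (p = 1 %[mod 8])%N ->
      pm3_mod8 (a + b) -> pm3_mod8 (a - b) ->
      S16 (64 * p%:Z)).

Proof.
split; first exact: S16_5mod8.
by split; [exact: S16_3mod8 | exact: S16_1mod8].
Qed.
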